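(* Let $G$ be a graphical cake represented by a finite connected graph of radius $r$, let two agents $A,B$ have valuations $v_A,v_B$ on $G$, and let $0\le t\le 1$ with entitlement vector $(t,1-t)$. Then there exists a weighted consensus division $(\alpha,\beta)$ of $G$ such that each of $\alpha$ and $\beta$ has at most $r+2$ connected components.
   Context: A graphical cake represented by a finite graph $G=(V,E)$ (loops and multiple edges allowed) consists of $|E|$ closed intervals, one per edge, with endpoints identified according to the incidence structure of $G$. A piece is a finite union of subintervals of edges; its connected pieces are its path components under the endpoint identifications. The radius of a connected graph is $\min_{v}\max_{w}d(v,w)$, with $d$ the graph distance. A valuation is a non-atomic Borel probability measure on the cake. A division between two agents is a pair of pieces $(\alpha,\beta)$ with $\alpha\cup\beta=G$ and $\alpha\cap\beta$ finite. Given entitlements $(t,1-t)$, $0\le t\le1$, a division is a weighted consensus division if $v_A(\alpha)=v_B(\alpha)=t$ and $v_A(\beta)=v_B(\beta)=1-t$. *)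

(* Defs.v *)
From HB Require Import structures.
From mathcomp Require Import all_boot all_order all_algebra.
From mathcomp Require Import all_classical all_reals all_analysis.
Set Implicit Arguments.
Unset Strict Implicit.
Unset Printing Implicit Defensive.
Import Order.TTheory GRing.Theory Num.Theory.
Local Open Scope classical_set_scope.
Local Open Scope ring_scope.

Section GraphicalCake.
Variables (R : realType) (V E : finType) (ends : E -> V * V).

(* a loop e has ends e = (v, v); multiple edges are distinct elements of E *)
Definition adj (v w : V) : bool :=
  [exists e : E, (ends e == (v, w)) || (ends e == (w, v))].

Fixpoint walk_le (n : nat) (v w : V) : bool :=
  match n with
  | 0 => v == w
  | n'.+1 => walk_le n' v w || [exists u, adj v u && walk_le n' u w]
  end.

Definition connected_graph : Prop := forall v w : V, exists n, walk_le n v w.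

(* graph distance (least n with a walk of length <= n); in a connected graph
   every distance is at most #|V| *)
Definition gdist (v w : V) : nat :=
  find (fun n => walk_le n v w) (iota 0 #|V|.+1).

Definition eccentricity (v : V) : nat := \max_(w : V) gdist v w.

Definition graph_radius : nat := \big[minn/#|V|]_(v : V) eccentricity v.

(* A point of the cake is represented by (e, x) with e an edge and
   0 <= x <= 1; x = 0 is the first endpoint of e, x = 1 the second. *)
Definition endvertex (e : E) (x : R) : option V :=
  if x == 0 then Some (ends e).1 else if x == 1 then Some (ends e).2 else None.

Definition same_point (p q : E * R) : Prop :=
  p = q \/ exists v : V, endvertex p.1 p.2 = Some v /\ endvertex q.1 q.2 = Some v.

Definition in_cake (p : E * R) : Prop := 0 <= p.2 <= 1.

(* a closed subinterval [a, b] of the edge e, encoded as (e, (a, b)) *)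
Definition subint := (E * (R * R))%type.

Definition wf_subint (I : subint) : Prop :=
  0 <= I.2.1 /\ I.2.1 <= I.2.2 /\ I.2.2 <= 1.

(* a piece: a finite union of closed subintervals of edges *)
Definition piece (s : seq subint) : Prop := forall I, I \in s -> wf_subint I.

Definition in_subint (I : subint) (p : E * R) : Prop :=
  exists y, I.2.1 <= y <= I.2.2 /\ same_point p (I.1, y).

Definition in_piece (s : seq subint) (p : E * R) : Prop :=
  exists2 I, I \in s & in_subint I p.

Definition meet (I J : subint) : Prop :=
  exists y z, I.2.1 <= y <= I.2.2 /\ J.2.1 <= z <= J.2.2 /\
              same_point (I.1, y) (J.1, z).

(* number of connected (= path) components of a piece: the classes of the
   equivalence generated by "the two closed intervals meet" *)
Definition num_components (s : seq subint) : nat :=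
  n_comp (fun i j : 'I_(size s) =>
            `[< meet (tnth (in_tuple s) i) (tnth (in_tuple s) j) >]) predT.

Definition division (a b : seq subint) : Prop :=
  piece a /\ piece b /\
  (forall p, in_cake p -> in_piece a p \/ in_piece b p) /\
  finite_set [set p : E * R | in_cake p /\ in_piece a p /\ in_piece b p].

(* A non-atomic Borel probability measure on the cake is given by its
   restrictions to the edges: one Borel measure per edge, carried by [0,1],
   non-atomic, with total mass 1. *)
Definition valuation (mu : E -> {measure set R -> \bar R}) : Prop :=
  (forall e, mu e [set x : R | ~ (0 <= x <= 1)] = 0%E) /\
  (forall e (x : R), mu e [set x] = 0%E) /\
  (\sum_(e : E) mu e [set x : R | (0 <= x <= 1)%R] = 1)%E.

Definition piece_on (s : seq subint) (e : E) : set R :=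
  [set x | 0 <= x <= 1 /\ in_piece s (e, x)].

Definition value (mu : E -> {measure set R -> \bar R}) (s : seq subint)
  : \bar R := (\sum_(e : E) mu e (piece_on s e))%E.

Definition weighted_consensus (muA muB : E -> {measure set R -> \bar R})
  (t : R) (a b : seq subint) : Prop :=
  division a b /\
  value muA a = t%:E /\ value muB a = t%:E /\
  value muA b = (1 - t)%:E /\ value muB b = (1 - t)%:E.

End GraphicalCake.

(* Main.v *)
Require Import Defs.
From HB Require Import structures.
From mathcomp Require Import all_boot all_order all_algebra.
From mathcomp Require Import all_classical all_reals all_analysis.
From mathcomp Require Import ring lra.
Import Order.TTheory GRing.Theory Num.Theory.
Import numFieldNormedType.Exports.
Set Implicit Arguments.
Unset Strict Implicit.
Unset Printing Implicit Defensive.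
Local Open Scope classical_set_scope.
Local Open Scope ring_scope.

(** Lay the oriented edges end to end on [0, |E|], in the order of a depth-first
    traversal of a breadth-first tree rooted at a center of the graph. By the
    intermediate value theorem some interval [x, y] has the same measure for both
    agents, equal to t or to 1 - t, so the part of the cake over [x, y] and its
    complement form a weighted consensus division.

    Each edge over [x, y] after the first one either continues an edge already
    met, or branches off at an ancestor of the first edge. There are at most r + 1
    ancestors, so [x, y] yields at most r + 2 components. The same count applies to
    the part over [y, |E|], and the part over [0, x] is connected and contains the
    root, which is one of these ancestors.

    The traversal order is obtained by repeatedly inserting a new edge right after
    the edge that first reached its tail; a list of maximal length contains all
    edges. *)

(** * Ordering the edges *)

(** Equal labels force equal components, so [f] is injective on the component roots. *)
Lemma n_comp_leq_size (I : finType) (e : rel I) (T : eqType) (A : seq T)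
    (f : I -> T) : connect_sym e -> (forall i, f i \in A) ->
  (forall i j, f i = f j -> connect e i j) -> (n_comp e predT <= size A)%N.
Proof.
move=> esym fA fE; set C := [predI roots e & predT].
have -> : n_comp e predT = size [seq f i | i <- enum C].
  by rewrite size_map -cardE; apply: eq_card.
apply: uniq_leq_size; last by move=> _ /mapP[i _ ->].
rewrite map_inj_in_uniq ?enum_uniq// => i j.
rewrite !mem_enum !inE !andbT => /eqP ri /eqP rj /fE cij.
by rewrite -ri -rj; apply/eqP; rewrite root_connect.
Qed.

(** * Walks and graph distance *)

Section Graph.
Variables (V E : finType) (ends : E -> V * V).

Lemma walk_le_path v p : path (adj ends) v p -> walk_le ends (size p) v (last v p).
Proof.
elim: p v => [|u p IH] v //= /andP[vu /IH up].
by apply/orP; right; apply/existsP; exists u; rewrite vu.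
Qed.

Lemma walk_le_connect n v w : walk_le ends n v w -> connect (adj ends) v w.
Proof.
elim: n v => [|n IH] v /=; first by move/eqP->.
case/orP => [/IH //|/existsP[u /andP[vu /IH]]].
exact/connect_trans/connect1.
Qed.

Lemma walk_le_refl n v : walk_le ends n v v.
Proof. by elim: n => [|n IH] /=; rewrite ?eqxx ?IH. Qed.

Lemma walk_le_rcons n v w : walk_le ends n.+1 v w -> v = w \/
  exists2 u, adj ends u w & walk_le ends n v u.
Proof.
elim: n v => [|n IH] v /=.
  case/orP => [/eqP ->|/existsP[u /andP[vu /eqP <-]]]; first by left.
  by right; exists v.
case/orP => [H|/existsP[u /andP[vu uw]]].
  have [->|[u uw vu]] := IH _ H; [by left | right; exists u => //].
  by rewrite vu.
have [<-|[u' uw' uu']] := IH _ uw.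
  by right; exists v => //; rewrite walk_le_refl.
right; exists u' => //; apply/orP; right; apply/existsP; exists u.
by rewrite vu.
Qed.

Hypothesis conn : connected_graph ends.

(** A walk shortens to a path without repeated vertices. The bound keeps the search defining [gdist]
    from running off the end of its range. *)
Lemma walk_le_card v w : walk_le ends #|V| v w.
Proof.
have [n /walk_le_connect /connectP[p vp ->]] := conn v w.
have [p' vp' up' _] := shortenP vp.
have sp : (size p' <= #|V|)%N.
  by rewrite ltnW //; have := max_card (mem (v :: p')); rewrite (card_uniqP up').
have /= := walk_le_path vp'; move: (last v p') => u.
elim: {vp' up'} #|V| sp => [|k IH]; first by rewrite leqn0 => /eqP ->.
by rewrite leq_eqVlt ltnS => /orP[/eqP-> //|/IH H /H /= ->].
Qed.

Lemma has_walk_le v w :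
  has (fun n => walk_le ends n v w) (iota 0 #|V|.+1).
Proof.
by apply/hasP; exists #|V|; rewrite ?walk_le_card// mem_iota/= ltnSn.
Qed.

Lemma gdist_le_card v w : (gdist ends v w <= #|V|)%N.
Proof. by have := has_walk_le v w; rewrite has_find size_iota ltnS. Qed.

Lemma gdist_walk_le v w : walk_le ends (gdist ends v w) v w.
Proof.
have := nth_find 0%N (has_walk_le v w).
by rewrite nth_iota ?add0n // ltnS gdist_le_card.
Qed.

Lemma walk_le_gdist n v w : walk_le ends n v w -> (gdist ends v w <= n)%N.
Proof.
move=> vw; rewrite leqNgt; apply/negP => lt_n.
have := before_find 0%N lt_n.
by rewrite nth_iota ?add0n ?vw// (leq_trans lt_n)// leqW ?gdist_le_card.
Qed.

(** [u] serves as the parent of [w] in a breadth-first tree rooted at [v]. *)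
Lemma gdist_pred v w : v != w ->
  exists2 u, adj ends u w & (gdist ends v u < gdist ends v w)%N.
Proof.
move=> vw; have := gdist_walk_le v w; case: (gdist ends v w) => [|n].
  by move=> /= vw'; rewrite vw' in vw.
case/walk_le_rcons => [/eqP|[u uw /walk_le_gdist vu]]; first by rewrite (negPf vw).
by exists u.
Qed.

Lemma graph_radius_center (v0 : V) :
  exists v, forall w, (gdist ends v w <= graph_radius ends)%N.
Proof.
have [v le_v] : exists v, (eccentricity ends v <= graph_radius ends)%N.
  rewrite /graph_radius; elim/big_ind: _ => //.
  (* The default [#|V|] of the iterated minimum bounds every eccentricity, so any vertex will do. *)
  - exists v0; apply/bigmax_leqP => w _; exact: gdist_le_card.
  - by move=> x y [v vx] [w wy]; rewrite /minn; case: ifP; [exists v | exists w].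
  - by move=> v _; exists v.
by exists v => w; apply: leq_trans le_v; rewrite /eccentricity leq_bigmax.
Qed.

(* An entry (e, (u, w), S) is the edge e traversed from u to w; S is meant to
   contain the vertices from which the traversal still branches off later. *)
Definition dart := (E * (V * V) * seq V)%type.
Definition dart_edge (k : dart) : E := k.1.1.
Definition src (k : dart) : V := k.1.2.1.
Definition dst (k : dart) : V := k.1.2.2.
Definition open_at (k : dart) : seq V := k.2.

Definition dart_of (k : dart) : bool :=
  (ends (dart_edge k) == (src k, dst k)) || (ends (dart_edge k) == (dst k, src k)).

Fixpoint attached (vs : seq V) (L : seq dart) : bool :=
  if L is k :: L' then (src k \in vs) && attached (dst k :: vs) L' else true.

(** Wherever the list is cut, the darts after the cut hang from the head or the open set of the last
    dart before it, as in a depth-first traversal. *)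
Fixpoint traversal (L : seq dart) : bool :=
  if L is k :: L' then attached (dst k :: open_at k) L' && traversal L' else true.

Lemma attached_sub vs vs' L : {subset vs <= vs'} -> attached vs L -> attached vs' L.
Proof.
elim: L vs vs' => [|k L IH] vs vs' //= sub /andP[/sub-> /=].
by apply: IH => v; rewrite !inE => /orP[->//|/sub ->]; rewrite orbT.
Qed.

Lemma attached_insert vs L1 j k L2 : src k = dst j ->
  attached vs (L1 ++ j :: L2) -> attached vs (L1 ++ j :: k :: L2).
Proof.
move=> kj; elim: L1 vs => [|h L1 IH] vs /= /andP[-> /=]; last exact: IH.
rewrite kj inE eqxx /=; apply: attached_sub => v vin.
by rewrite inE vin orbT.
Qed.

(** A cut after [k] must serve every dart that a cut after [j] served through [dst j] or
    [open_at j]; hence the open set of [k]. Earlier cuts only gain a head. *)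
Lemma traversal_insert L1 j k L2 : src k = dst j -> open_at k = dst j :: open_at j ->
  traversal (L1 ++ j :: L2) -> traversal (L1 ++ j :: k :: L2).
Proof.
move=> kj Sk; elim: L1 => [|h L1 IH] /= /andP[att tr]; last first.
  by rewrite IH // attached_insert.
rewrite tr kj Sk inE eqxx /= andbT; apply/andP; split;
  by apply: attached_sub att => v vin; rewrite inE vin orbT.
Qed.

Lemma attached_nth k0 vs L k : attached vs L -> (k < size L)%N ->
  src (nth k0 L k) \in vs \/
  exists2 j, (j < k)%N & dst (nth k0 L j) = src (nth k0 L k).
Proof.
elim: L vs k => [|h L IH] vs [|k] //= /andP[hv att]; first by left.
rewrite ltnS => /(IH _ _ att)[|[j jk E']]; last by right; exists j.+1.
by rewrite inE => /orP[/eqP ->|]; [right; exists 0%N | left].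
Qed.

Lemma traversal_nth k0 L i k : traversal L -> (i < k < size L)%N ->
  src (nth k0 L k) \in open_at (nth k0 L i) \/
  exists2 j, (i <= j < k)%N & dst (nth k0 L j) = src (nth k0 L k).
Proof.
elim: L i k => [|h L IH] i [|k] //=; rewrite ?ltn0 ?andbF// => /andP[att tr].
case: i => [|i] /=; last first.
  by rewrite !ltnS => /(IH _ _ tr)[|[j]]; [left | right; exists j.+1].
rewrite ltnS => /(attached_nth k0 att)[|[j jk E']]; last by right; exists j.+1.
by rewrite inE => /orP[/eqP ->|]; [right; exists 0%N | left].
Qed.

(** * Growing a traversal with open sets bounded by the distance to the root *)

Section Traversal.
Variable root : V.
Let d := gdist ends root.

(** The size condition lets a dart inserted at [v] have an open set one larger, of size at most
    [d v + 1]. This is how the radius comes to bound all open sets. *)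
Definition reached (L : seq dart) (v : V) : bool :=
  (v == root) || has (fun j => (dst j == v) && (size (open_at j) <= d v)%N) L.

Definition good_traversal (L : seq dart) : bool :=
  [&& uniq (map dart_edge L), attached [:: root] L, traversal L &
      all (fun k => [&& dart_of k, root \in open_at k,
        (size (open_at k) <= (d (src k)).+1)%N & reached L (src k)]) L].

Lemma reached_sub L L' v : {subset L <= L'} -> reached L v -> reached L' v.
Proof.
rewrite /reached => sub /orP[->//|/hasP[j /sub jL' H]]; apply/orP; right.
by apply/hasP; exists j.
Qed.

Lemma good_traversal_extend L e u w : good_traversal L -> e \notin map dart_edge L ->
  reached L u -> (ends e == (u, w)) || (ends e == (w, u)) ->
  exists2 L', good_traversal L' & size L' = (size L).+1.
Proof.
move=> /and4P[uL aL tL /allP gL] eL ru ew.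
case/orP: (ru) => [/eqP ur|/hasP[j jL /andP[/eqP ju sj]]].
  (* An edge at the root goes in front: the whole of [L] is attached to [root], which is in the new
     open set. *)
  exists ((e, (u, w), [:: root]) :: L) => //; apply/and4P; split => /=.
  - by rewrite eL.
  - rewrite ur inE eqxx /=; apply: attached_sub aL => v vin.
    by rewrite inE vin orbT.
  - rewrite tL andbT; apply: attached_sub aL => v vin.
    by rewrite inE vin orbT.
  - rewrite {1}/dart_of /= ew inE eqxx /= [reached _ u]/reached ur eqxx /=.
    apply/allP => k kL; have /and4P[-> -> -> rk] := gL k kL; rewrite /=.
    by apply: reached_sub rk => x xL; rewrite inE xL orbT.
have [L1 [L2 LE]] : exists L1 L2, L = L1 ++ j :: L2.
  by case/splitPr: jL => L1 L2; exists L1, L2.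
set k := (e, (u, w), dst j :: open_at j).
have sub : {subset L <= L1 ++ j :: k :: L2}.
  by move=> x; rewrite LE !mem_cat !inE => /or3P[]->; rewrite ?orbT.
have perm : perm_eq (L1 ++ j :: k :: L2) (k :: L).
  by rewrite LE -cat_rcons -[j :: L2]cat1s catA cats1 perm_catC /= perm_cons perm_catC.
exists (L1 ++ j :: k :: L2); last by rewrite (perm_size perm).
rewrite /good_traversal; apply/and4P; split.
- by rewrite (perm_uniq (perm_map dart_edge perm)) /= eL.
- by apply: attached_insert; rewrite -?LE // /k /src /= ju.
- by apply: traversal_insert; rewrite -?LE // /k /src /= ju.
- rewrite (perm_all _ perm) /=; apply/andP; split.
    rewrite {1}/dart_of /= ew /= [src k]/= (reached_sub sub ru) ltnS sj !andbT.
    by have /and4P[_ rj _ _] := gL j jL; rewrite /open_at /= inE rj orbT.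
  apply/allP => x xL; have /and4P[-> -> -> rk] := gL x xL.
  exact: reached_sub rk.
Qed.

Lemma good_traversal_size L : good_traversal L -> (size L <= #|E|)%N.
Proof.
by case/and4P => uL _ _ _; rewrite -(size_map dart_edge) -(card_uniqP uL) max_card.
Qed.

Lemma exists_good_traversal :
  exists2 L, good_traversal L & forall e, e \in map dart_edge L.
Proof.
have [n /asboolP[L gL sL] max_n] : exists2 n,
    `[< exists2 L, good_traversal L & size L = n >] &
    forall k, `[< exists2 L, good_traversal L & size L = k >] -> (k <= n)%N.
  have ex : exists n, `[< exists2 L, good_traversal L & size L = n >].
    by exists 0%N; apply/asboolP; exists [::].
  have ub k : `[< exists2 L, good_traversal L & size L = k >] -> (k <= #|E|)%N.
    by move=> /asboolP[L gL <-]; exact: good_traversal_size.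
  by case: (ex_maxnP ex ub) => n Pn max_n; exists n.
(* By maximality, an edge with a reached endpoint already occurs in the list. *)
have add e u w : reached L u -> (ends e == (u, w)) || (ends e == (w, u)) ->
    e \in map dart_edge L.
  move=> ru ew; apply/negPn/negP => eL.
  have [L' gL' sL'] := good_traversal_extend gL eL ru ew.
  have : ((size L).+1 <= n)%N by apply: max_n; apply/asboolP; exists L'.
  by rewrite sL ltnn.
(* Induction on the distance: the breadth-first parent [u] of [v] is reached, so the edge joining
   them occurs as a dart [j]. *)
have all_reached v : reached L v.
  have [k] := ubnP (d v); elim: k v => // k IH v dv.
  have [->|] := eqVneq v root; first by rewrite /reached eqxx.
  rewrite eq_sym => rv.
  have [u /existsP[e uv] du] := gdist_pred rv.
  have /mapP[j jL ej] := add _ _ _ (IH u (leq_trans du dv)) uv.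
  have /and4P[_ _ _ /allP/(_ j jL)/and4P[oj _ sj rj]] := gL.
  move: uv oj; rewrite ej /dart_of => uv oj.
  (* If [j] runs from [u] to [v], its open set has at most [d u + 1 <= d v] elements; if it starts
     at [v], then [v] is reached because all sources are. *)
  have : [|| (src j == u) && (dst j == v) | src j == v].
    case/orP: uv oj => /eqP -> /orP[] /eqP[-> ->]; rewrite !eqxx ?orbT //.
  case/orP => [/andP[/eqP su /eqP dv']|/eqP <-//].
  apply/orP; right; apply/hasP; exists j => //.
  by rewrite dv' eqxx /= (leq_trans sj)// su.
exists L => // e; apply: (add e (ends e).1 (ends e).2) => //.
by rewrite -surjective_pairing eqxx.
Qed.

End Traversal.
End Graph.

Lemma traversal_order (V E : finType) (ends : E -> V * V) (v0 : V) :
  connected_graph ends ->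
  exists (root : V) (pos : E -> nat) (tl hd : E -> V) (op : E -> seq V),
  injective pos /\ (forall e, (pos e < #|E|)%N) /\
  (forall i, (i < #|E|)%N -> exists e, pos e = i) /\
  (forall e, ends e = (tl e, hd e) \/ ends e = (hd e, tl e)) /\
  (forall e, tl e = root \/ exists2 f, (pos f < pos e)%N & hd f = tl e) /\
  (forall e f, (pos e < pos f)%N -> tl f \in op e \/
     exists2 g, (pos e <= pos g < pos f)%N & hd g = tl f) /\
  (forall e, root \in op e /\ (size (op e) <= (graph_radius ends).+1)%N).
Proof.
move=> conn; have [root le_r] := graph_radius_center conn v0.
have [L /and4P[uL aL tL /allP gL] allL] := exists_good_traversal conn root.
(* [nth] needs a default dart, hence an edge; without edges all claims are vacuous. *)
case: (pselect (exists e : E, True)) => [[e0 _]|noE]; last first.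
  have F (e : E) : False by apply: noE; exists e.
  have E0 : #|E| = 0%N by apply: eq_card0 => e; case: (F e).
  exists root, (fun=> 0%N), (fun=> root), (fun=> root), (fun=> [::]).
  split; first by move=> e; case: (F e).
  by rewrite E0; do !split=> //; move=> e; case: (F e).
pose k0 : dart V E := (e0, (root, root), [::]).
have sL : size L = #|E|.
  rewrite -(size_map (@dart_edge V E)) -(card_uniqP uL); apply: eq_card => e.
  by rewrite allL.
pose pos e := index e (map (@dart_edge V E) L).
pose A e := nth k0 L (pos e).
have pos_lt e : (pos e < #|E|)%N.
  by rewrite -sL -(size_map (@dart_edge V E)) index_mem allL.
have edgeA e : dart_edge (A e) = e.
  by rewrite /A -(nth_map k0 e0) ?sL // nth_index ?allL.
have AL e : A e \in L by rewrite mem_nth // sL.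
have nthA i : (i < #|E|)%N -> exists2 e, pos e = i & A e = nth k0 L i.
  move=> i_lt; exists (dart_edge (nth k0 L i)).
    by rewrite /pos -(nth_map k0 e0) ?sL // index_uniq ?size_map ?sL.
  by rewrite /A /pos -{1}(nth_map k0 e0) ?sL // index_uniq ?size_map ?sL.
exists root, pos, (fun e => src (A e)), (fun e => dst (A e)), (fun e => open_at (A e)).
split; first by move=> e f pe; rewrite -(edgeA e) -(edgeA f) /A pe.
split; first exact: pos_lt.
split; first by move=> i /nthA[e <-]; exists e.
split.
  move=> e; have /and4P[+ _ _ _] := gL _ (AL e).
  by rewrite /dart_of edgeA => /orP[] /eqP; [left | right].
split.
  move=> e; have := attached_nth k0 aL (k := pos e).
  rewrite sL => /(_ (pos_lt e)) [|[j je jd]].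
    by rewrite inE => /eqP; left.
  have [f fj Af] := nthA _ (ltn_trans je (pos_lt e)).
  by right; exists f; rewrite ?fj // Af.
split.
  move=> e f ef; have := traversal_nth k0 tL (i := pos e) (k := pos f).
  rewrite sL ef pos_lt => /(_ isT) [|[j /andP[ej jf] jd]]; first by left.
  have [g gj Ag] := nthA _ (ltn_trans jf (pos_lt f)).
  by right; exists g; rewrite ?gj ?ej // Ag.
move=> e; have /and4P[_ rk sk _] := gL _ (AL e); split => //.
by apply: leq_trans sk _; rewrite ltnS.
Qed.

(** * Two measures on a circle *)

(** The retraction of the line onto [0, 1]. It extends functions from [0, 1] to the line, and later
    locates a cut point relative to an edge. *)
Definition clamp (R : realType) (x : R) : R := Num.max 0 (Num.min 1 x).

Section Clamp.
Variable R : realType.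
Implicit Types x y : R.

Lemma clamp_ge0 x : 0 <= clamp x.
Proof. by rewrite /clamp le_max lexx. Qed.

Lemma clamp_le1 x : clamp x <= 1.
Proof. by rewrite /clamp ge_max ler01 ge_min lexx. Qed.

Lemma clamp_id x : 0 <= x <= 1 -> clamp x = x.
Proof. by case/andP => x0 x1; rewrite /clamp (min_idPr x1) (max_idPr x0). Qed.

Lemma clamp0 x : x <= 0 -> clamp x = 0.
Proof. by move=> x0; rewrite /clamp; apply/max_idPl; rewrite ge_min x0 orbT. Qed.

Lemma clamp1 x : 1 <= x -> clamp x = 1.
Proof. by move=> x1; rewrite /clamp (min_idPl x1); apply/max_idPr. Qed.

Lemma clamp_le x y : x <= y -> clamp x <= clamp y.
Proof.
move=> xy; have [x0|x0] := leP x 0; first by rewrite (clamp0 x0) clamp_ge0.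
have [y1|y1] := leP 1 y; first by rewrite (clamp1 y1) clamp_le1.
by rewrite !clamp_id //; lra.
Qed.

Lemma clamp_lipschitz x y : `|clamp x - clamp y| <= `|x - y|.
Proof.
wlog xy : x y / y <= x => [H|].
  by have [/H//|/ltW/H] := leP y x; rewrite distrC (distrC y).
rewrite !ger0_norm ?subr_ge0 ?clamp_le //.
have [y0|y0] := leP y 0; last have [y1|y1] := leP 1 y.
- rewrite (clamp0 y0); have [x0|x0] := leP x 0; first by rewrite (clamp0 x0); lra.
  have [x1|x1] := leP 1 x; first by rewrite (clamp1 x1); lra.
  by rewrite clamp_id; lra.
- by rewrite (clamp1 y1) clamp1; lra.
- rewrite (@clamp_id y); last by lra.
  have [x1|x1] := leP 1 x; first by rewrite (clamp1 x1); lra.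
  by rewrite clamp_id; lra.
Qed.

Lemma lipschitz1_continuous (f : R -> R) :
  (forall x y, `|f x - f y| <= `|x - y|) -> continuous f.
Proof.
move=> lipf x; apply/cvgrPdist_lt => e e0; near=> y.
apply: le_lt_trans (lipf x y) _; near: y.
by have /cvgrPdist_lt := @cvg_id _ (nbhs x); apply.
Unshelve. all: by end_near. Qed.

(* The difference [p (s + t) - p s] is <= 0 at a maximum of [p] and >= 0 at a
   minimum. *)
Lemma periodic_chord (p : R -> R) (t : R) : continuous p -> 0 <= t <= 1 ->
  (forall s, 0 <= s <= 1 -> p (s + 1) = p s) ->
  exists2 s, 0 <= s <= 1 & p (s + t) = p s.
Proof.
move=> cp t01 per.
have [c c01 max_c] := @EVT_max R p 0 1 ler01 (continuous_subspaceT cp).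
have [c' c'01 min_c] := @EVT_min R p 0 1 ler01 (continuous_subspaceT cp).
have shift s : 0 <= s <= 1 -> p c' <= p (s + t) <= p c.
  move=> s01; have [st|st] := leP (s + t) 1.
    by rewrite max_c ?min_c // in_itv /=; lra.
  have -> : s + t = (s + t - 1) + 1 by ring.
  by rewrite per ?max_c ?min_c ?in_itv //=; lra.
pose k s := p (s + t) - p s.
have ck : continuous k.
  move=> s; apply: continuousB (cp s).
  apply: continuous_comp; last exact: cp.
  by apply: continuousD; [exact: cvg_id | exact: cvg_cst].
rewrite !in_itv /= in c01 c'01.
have kc : k c <= 0 by have := shift c c01; rewrite /k; lra.
have kc' : 0 <= k c' by have := shift c' c'01; rewrite /k; lra.
have [s s01 ks] : exists2 s, 0 <= s <= 1 & k s = 0.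
  have [cc|/ltW cc] := leP c c'.
    have [|s] := @IVT R k c c' 0 cc (continuous_subspaceT ck).
      by rewrite ge_min kc le_max kc' orbT.
    by rewrite in_itv /= => ss ks; exists s => //; lra.
  have [|s] := @IVT R k c' c 0 cc (continuous_subspaceT ck).
    by rewrite ge_min kc orbT le_max kc'.
  by rewrite in_itv /= => ss ks; exists s => //; lra.
by exists s => //; move: ks; rewrite /k; lra.
Qed.

(* Reparametrize by s = (F + G) / 2, in which F becomes Lipschitz; then a
   single equation in s controls both increments. *)
Lemma two_measure_arc (F G : R -> R) (m t : R) : continuous F -> continuous G ->
  {homo F : x y / x <= y} -> {homo G : x y / x <= y} -> 0 <= m ->
  F 0 = 0 -> G 0 = 0 -> F m = 1 -> G m = 1 -> 0 <= t <= 1 ->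
  exists x y, 0 <= x /\ x <= y /\ y <= m /\
    ((F y - F x = t /\ G y - G x = t) \/ (F y - F x = 1 - t /\ G y - G x = 1 - t)).
Proof.
move=> cF cG hF hG m0 F0 G0 Fm Gm t01.
(* [q] picks a point where [F + G] equals 2s. It may jump; only its monotonicity is used. *)
have /choice[q qP] : forall s : R, exists z : R, 0 <= s <= 1 ->
    0 <= z <= m /\ F z + G z = 2 * s.
  move=> s; have [s01|s01] := boolP (0 <= s <= 1); last by exists 0.
  have cFG : continuous (fun z => F z + G z).
    by move=> z; apply: continuousD; [exact: cF | exact: cG].
  have [|z] := @IVT R (fun z => F z + G z) 0 m (2 * s) m0 (continuous_subspaceT cFG).
    by rewrite F0 G0 Fm Gm (@min_idPl _ _ _ _ _) ?(@max_idPr _ _ _ _ _); lra.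
  by rewrite in_itv /= => zm zs; exists z.
have q_lt (a b : R) : 0 <= a -> a < b -> b <= 1 -> q a <= q b.
  move=> a0 ab b1; have /qP[_ Ea] : 0 <= a <= 1 by lra.
  have /qP[_ Eb] : 0 <= b <= 1 by lra.
  by rewrite leNgt; apply/negP => /ltW ba; have := hF _ _ ba; have := hG _ _ ba; lra.
have q_le (a b : R) : 0 <= a -> a <= b -> b <= 1 -> q a <= q b.
  by move=> a0; rewrite le_eqVlt => /orP[/eqP-> //|]; exact: q_lt.
(* Along [q] the increments of [F] and [G] are nonnegative with sum 2(b - a), so that of [F] lies
   between 0 and 2(b - a). Subtracting s leaves a 1-Lipschitz function. *)
pose h (s : R) : R := F (q s) - s.
have h_lip a b : 0 <= a <= 1 -> 0 <= b <= 1 -> `|h a - h b| <= `|a - b|.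
  wlog ab : a b / a <= b => [H a01 b01|a01 b01].
    by have [/H|/ltW/H] := leP a b; [|rewrite distrC (distrC a)]; apply.
  have [_ Ea] := qP _ a01; have [_ Eb] := qP _ b01.
  have qab : q a <= q b by apply: q_le; lra.
  have := hF _ _ qab; have := hG _ _ qab => Gab Fab.
  rewrite (ler0_norm (x := a - b)) ?subr_le0 // ler_norml /h; lra.
have h0 : h 0 = 0.
  have /qP[q0 E0] : 0 <= (0 : R) <= 1 by lra.
  have /andP[/hF + _] := q0; have /andP[/hG + _] := q0.
  by move: E0; rewrite /h F0 G0; lra.
have h1 : h 1 = 0.
  have /qP[q1 E1] : 0 <= (1 : R) <= 1 by lra.
  have /andP[_ /hF +] := q1; have /andP[_ /hG +] := q1.
  by move: E1; rewrite /h Fm Gm; lra.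
have c_hc : continuous (h \o @clamp R).
  apply: lipschitz1_continuous => x y /=; apply: le_trans (clamp_lipschitz x y).
  by apply: h_lip; rewrite clamp_ge0 clamp_le1.
(* Since [h] vanishes at 0 and 1, each summand is zero off its own unit interval; the sum repeats
   [h] on [0, 1] and on [1, 2]. *)
pose p (s : R) : R := h (clamp s) + h (clamp (s - 1)).
have cp : continuous p.
  move=> s; apply: (@continuousD _ _ _ (h \o @clamp R)); first exact: c_hc.
  have c_shift : {for s, continuous (fun s : R => s - 1)}.
    by apply: continuousB; [exact: cvg_id | exact: cvg_cst].
  exact: (continuous_comp c_shift (c_hc _)).
have p_lo s : 0 <= s <= 1 -> p s = h s.
  by move=> s01; rewrite /p clamp_id // (@clamp0 (s - 1)) ?h0 ?addr0 //; lra.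
have p_hi s : 0 <= s <= 1 -> p (s + 1) = h s.
  by move=> s01; rewrite /p addrK (clamp_id s01) clamp1 ?h1 ?add0r //; lra.
have [s s01 ps] : exists2 s, 0 <= s <= 1 & p (s + t) = p s.
  by apply: periodic_chord => // s s01; rewrite p_hi // p_lo.
rewrite (p_lo s) // in ps.
(* [ps] makes the increment of [F] equal to t; as [F + G] grows by 2t, that of [G] is t too. *)
have [st|st] := leP (s + t) 1.
  rewrite p_lo in ps; last by lra.
  have /qP[qs Es] : 0 <= s <= 1 by lra.
  have /qP[qst Est] : 0 <= s + t <= 1 by lra.
  have qq : q s <= q (s + t) by apply: q_le; lra.
  exists (q s), (q (s + t)); do 3 (split; first by lra).
  by left; move: ps; rewrite /h; split; lra.
(* The arc wraps past the end, so the interval from [q (s + t - 1)] to [q s] that it leaves out is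
   taken, with measure 1 - t. *)
have st1 : 0 <= s + t - 1 <= 1 by lra.
rewrite -(subrK 1 (s + t)) p_hi // in ps.
have /qP[qs Es] : 0 <= s <= 1 by lra.
have /qP[qst Est] : 0 <= s + t - 1 <= 1 by lra.
have qq : q (s + t - 1) <= q s by apply: q_le; lra.
exists (q (s + t - 1)), (q s); do 3 (split; first by lra).
by right; move: ps; rewrite /h; split; lra.
Qed.

End Clamp.

(** * Non-atomic measures on the unit interval *)

Section EdgeMeasure.
Variables (R : realType) (nu : {measure set R -> \bar R}).
Hypothesis nu_out : nu [set x : R | ~ (0 <= x <= 1)] = 0%E.
Hypothesis nu_atom : forall x : R, nu [set x] = 0%E.
Hypothesis nu_fin : (nu [set x : R | (0 <= x <= 1)%R] < +oo)%E.

Lemma unit_itvE : [set x : R | 0 <= x <= 1] = `[0, 1]%classic.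
Proof. by apply/seteqP; split => x /=; rewrite in_itv. Qed.

Lemma finite_set_measurable (N : set R) : finite_set N -> measurable N.
Proof. by move=> /finite_set_countable; exact: countable_measurable. Qed.

Lemma finite_set_null (N : set R) : finite_set N -> nu N = 0%E.
Proof.
move=> /finite_seqP[s ->]; elim: s => [|x s IH].
  by rewrite classical_sets.set_nil measure0.
have -> : [set` x :: s] = [set` s] `|` [set x].
  apply/seteqP; split => z /=; rewrite inE; first by case/orP => [/eqP|]; [right | left].
  by case=> [->|->]; rewrite ?orbT ?eqxx.
rewrite measureU0 ?IH //; exact: finite_set_measurable.
Qed.

(** Finite sets are null by non-atomicity. This absorbs the endpoints that a piece gains on an edge
    through the identification of vertices. *)
Lemma measurable_up_to_finite (A B : set R) : measurable B -> B `<=` A ->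
  finite_set (A `\` B) -> measurable A /\ nu A = nu B.
Proof.
move=> mB BA fin; rewrite -(setDUK BA).
have mD := finite_set_measurable fin.
by split; [exact: measurableU | rewrite measureU0 // finite_set_null].
Qed.

Lemma nu_setT : nu setT = nu `[0, 1]%classic.
Proof.
rewrite -(setUv `[0, 1]%classic) measureU0 //; first exact: measurableC.
Qed.

Lemma nu_fin_num A : measurable A -> nu A \is a fin_num.
Proof.
move=> mA; rewrite ge0_fin_numE //; apply: le_lt_trans nu_fin.
by rewrite unit_itvE -nu_setT le_measure ?inE.
Qed.

Definition distr (y : R) : R := fine (nu `]-oo, y]%classic).

Lemma distr_itv_oc a b : a <= b -> nu `]a, b]%classic = (distr b - distr a)%:E.
Proof.
move=> ab; rewrite EFinB /distr !fineK ?nu_fin_num //.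
have -> : `]-oo, b]%classic = `]-oo, a]%classic `|` `]a, b]%classic.
  by rewrite -itv_bndbnd_setU.
rewrite measureU //; last first.
  apply/seteqP; split => x //= []; rewrite !in_itv /= => xa /andP[ax _]; lra.
by rewrite addeAC subee ?nu_fin_num // add0e.
Qed.

Lemma distr_itv a b : a <= b -> nu `[a, b]%classic = (distr b - distr a)%:E.
Proof.
move=> ab; rewrite -distr_itv_oc // -(@setU1itv _ _ (BRight b) a false) //.
by rewrite setUC measureU0.
Qed.

Lemma distr_homo : {homo distr : x y / x <= y}.
Proof. by move=> a b ab; rewrite -subr_ge0 -lee_fin -distr_itv_oc. Qed.

Lemma distr0 y : y <= 0 -> distr y = 0.
Proof.
move=> y0; rewrite /distr.
have -> : nu `]-oo, y]%classic = nu `]-oo, y[%classic.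
  apply: (measurable_up_to_finite _ _ _).2 => //.
    by move=> x /=; rewrite !in_itv /=; exact: ltW.
  apply: (@sub_finite_set _ _ [set y]) => // x []/=; rewrite !in_itv /=; lra.
rewrite (@subset_measure0 _ _ _ nu _ [set x : R | ~ (0 <= x <= 1)]) //.
- by rewrite (_ : mkset _ = ~` `[0, 1]%classic) -?unit_itvE //; apply: measurableC;
    rewrite unit_itvE.
- by move=> x /=; rewrite in_itv /=; lra.
Qed.

Lemma distr1 y : 1 <= y -> distr y = fine (nu setT).
Proof.
move=> y1; rewrite /distr; congr fine; apply/eqP; rewrite eq_le le_measure ?inE //=.
by rewrite nu_setT le_measure ?inE // => x /=; rewrite !in_itv /=; lra.
Qed.

(** The intervals around [y] shrink to the null set [[set y]], so their measures tend to 0;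
    monotonicity then squeezes [distr]. *)
Lemma distr_continuous : continuous distr.
Proof.
move=> y; apply/cvgrPdist_lt => e e0.
pose r (n : nat) : R := n.+1%:R^-1.
have r0 n : 0 < r n by rewrite /r invr_gt0.
pose F (n : nat) : set R := `]y - r n, y + r n]%classic.
have capF : \bigcap_n F n = [set y].
  apply/seteqP; split => [x xF|_ -> n _]; last first.
    by rewrite /F /= in_itv /=; have := r0 n; lra.
  apply/eqP; rewrite -subr_eq0 -normr_eq0 eq_le normr_ge0 andbT leNgt.
  apply/negP => xy; have [n] := ltr_add_invr xy.
  rewrite add0r -/(r n) => ny; have := xF n I; rewrite /F /= in_itv /= => /andP[xl xr].
  have : `|x - y| <= r n by rewrite ler_norml; lra.
  lra.
have : nu \o F @ \oo --> nu (\bigcap_n F n).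
  apply: nonincreasing_cvg_mu => //.
  - by rewrite -ge0_fin_numE //; apply: nu_fin_num; exact: measurable_itv.
  - by move=> n; exact: measurable_itv.
  - by rewrite capF.
  move=> m n mn; apply/subsetPset => x; rewrite /F /= !in_itv /=.
  have : r n <= r m by rewrite /r lef_pV2 ?posrE // ler_nat.
  lra.
rewrite capF nu_atom => /fine_cvgP[_ /cvgrPdist_lt/(_ e e0)] [N _ /(_ N (leqnn N))].
rewrite /= sub0r normrN => FN.
have N0 := r0 N.
have FNE : fine (nu (F N)) = distr (y + r N) - distr (y - r N).
  by rewrite /F distr_itv_oc //; lra.
have {}FN : distr (y + r N) - distr (y - r N) < e.
  by rewrite -FNE; apply: le_lt_trans FN; rewrite ler_norm.
near=> z.
have zy : `|y - z| <= r N.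
  by near: z; have /cvgrPdist_le := @cvg_id _ (nbhs y); apply.
have [z1 z2] : y - r N <= z /\ z <= y + r N.
  by move: zy; rewrite ler_norml; lra.
have D1 := distr_homo z1; have D2 := distr_homo z2.
have D3 : distr (y - r N) <= distr y by apply: distr_homo; lra.
have D4 : distr y <= distr (y + r N) by apply: distr_homo; lra.
by rewrite ltr_norml; lra.
Unshelve. all: by end_near. Qed.

(** The distribution function along an edge traversed forwards, or, for [o] false, backwards from
    the endpoint 1. *)
Definition cumul (o : bool) (y : R) : R :=
  if o then distr y else fine (nu setT) - distr (1 - y).

Lemma cumul_homo o : {homo cumul o : x y / x <= y}.
Proof.
move=> x y xy; case: o => /=; first exact: distr_homo.
by rewrite lerD2l lerN2 distr_homo //; lra.
Qed.

Lemma cumul0 o y : y <= 0 -> cumul o y = 0.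
Proof.
case: o => y0; rewrite /cumul; first exact: distr0.
by rewrite distr1 ?subrr //; lra.
Qed.

Lemma cumul1 o y : 1 <= y -> cumul o y = fine (nu setT).
Proof.
case: o => y1; rewrite /cumul; first exact: distr1.
by rewrite distr0 ?subr0 //; lra.
Qed.

Lemma cumul_clamp o y : cumul o (clamp y) = cumul o y.
Proof.
have [y0|y0] := leP y 0; first by rewrite (clamp0 y0) !cumul0.
have [y1|y1] := leP 1 y; first by rewrite (clamp1 y1) !cumul1.
by rewrite clamp_id //; lra.
Qed.

Lemma cumul_continuous o : continuous (cumul o).
Proof.
case: o => y; first exact: distr_continuous.
have c1 : {for y, continuous (fun y : R => 1 - y)}.
  by apply: continuousB; [exact: cvg_cst | exact: cvg_id].
have c2 := continuous_comp c1 (@distr_continuous (1 - y)).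
by apply: (@continuousB _ _ _ (fun=> fine (nu setT))) c2; exact: cvg_cst.
Qed.

End EdgeMeasure.

(** * Pieces over an interval *)

Section Components.
Variables (R : realType) (V E : finType) (ends : E -> V * V).
Local Notation subint := (subint R E).
Local Notation meet := (@meet R V E ends).

Lemma meet_sym (I J : subint) : meet I J -> meet J I.
Proof.
move=> [y [z [yI [zJ yz]]]]; exists z, y; split => //; split => //.
by case: yz => [->|[v [? ?]]]; [left | right; exists v].
Qed.

Lemma meet_refl (I : subint) : wf_subint I -> meet I I.
Proof.
move=> [_ [I12 _]]; exists I.2.1, I.2.1; rewrite lexx I12.
by do 2 split => //; left.
Qed.

Definition touch (I : subint) (v : V) :=
  exists2 z, I.2.1 <= z <= I.2.2 & endvertex ends I.1 z = Some v.

Lemma touch_meet (I J : subint) v : touch I v -> touch J v -> meet I J.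
Proof.
by move=> [y yI yv] [z zJ zv]; exists y, z; do 2 split => //; right; exists v.
Qed.

(** An interval without a label meets one of smaller rank, so descent ends at a labelled interval of
    the same component. Intervals sharing a label meet, so labels bound components. *)
Lemma num_components_leq (s : seq subint) (T : eqType) (A : seq T)
    (tau : T -> subint -> Prop) (rk : subint -> nat) :
  (forall c I J, I \in s -> J \in s -> tau c I -> tau c J -> meet I J) ->
  (forall I, I \in s -> (exists2 c, c \in A & tau c I) \/
     (exists2 J, J \in s & (rk J < rk I)%N /\ meet J I)) ->
  (num_components ends s <= size A)%N.
Proof.
move=> tau_meet cover; rewrite /num_components.
set e := (fun i j => _); pose S := tnth (in_tuple s).
have esym : connect_sym e.
  by apply: sym_connect_sym => i j; apply/asboolP/asboolP; exact: meet_sym.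
have Ss i : S i \in s by exact: mem_tnth.
have label i : exists c, c \in A /\ exists2 j, connect e i j & tau c (S j).
  have [n] := ubnP (rk (S i)); elim: n i => // n IH i rki.
  have [[c cA ci]|[J Js [JI mJI]]] := cover _ (Ss i).
    by exists c; split => //; exists i.
  have /tnthP[j Jj] : J \in in_tuple s by [].
  have [|c [cA [k jk ck]]] := IH j; first by rewrite /S -Jj (leq_trans JI).
  exists c; split => //; exists k => //; apply: connect_trans jk; apply: connect1.
  by apply/asboolP; apply: meet_sym; rewrite -Jj.
have [f fP] := choice label.
apply: (n_comp_leq_size (f := f)) => // [i|i j fij]; first by have [] := fP i.
have [_ [i' ii' ti]] := fP i; have [_ [j' jj' tj]] := fP j.
apply: connect_trans ii' _; rewrite esym; apply: connect_trans jj' _.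
apply: connect1; apply/asboolP; apply: tau_meet (Ss j') (Ss i') tj _.
by rewrite -fij.
Qed.

End Components.

(** * Arcs of the laid-out cake and their components *)

Section Pieces.
Variables (R : realType) (V E : finType) (ends : E -> V * V).
Variables (root : V) (pos : E -> nat) (tl hd : E -> V) (op : E -> seq V) (r : nat).
Hypothesis pos_inj : injective pos.
Hypothesis pos_lt : forall e, (pos e < #|E|)%N.
Hypothesis pos_onto : forall i, (i < #|E|)%N -> exists e, pos e = i.
Hypothesis ends_tl_hd : forall e, ends e = (tl e, hd e) \/ ends e = (hd e, tl e).
Hypothesis tl_prefix :
  forall e, tl e = root \/ exists2 f, (pos f < pos e)%N & hd f = tl e.
Hypothesis tl_open : forall e f, (pos e < pos f)%N -> tl f \in op e \/
  exists2 g, (pos e <= pos g < pos f)%N & hd g = tl f.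
Hypothesis op_root_size : forall e, root \in op e /\ (size (op e) <= r.+1)%N.

Local Notation subint := (subint R E).
Local Notation m := (#|E|%:R : R).

Definition fwd (e : E) : bool := ends e == (tl e, hd e).
(** Converts between the coordinate of [e] and the one measured from its tail [tl e]; an
    involution. *)
Definition flip (e : E) (z : R) : R := if fwd e then z else 1 - z.
Definition off (x : R) (e : E) : R := clamp (x - (pos e)%:R).
Definition edge_part (x y : R) (e : E) : subint :=
  (e, if fwd e then (off x e, off y e) else (1 - off y e, 1 - off x e)).
(* The edges are laid end to end on [0, #|E|] in the order [pos]; [arc_piece x y]
   is the part of the cake lying over [x, y]. *)
Definition arc_piece (x y : R) : seq subint :=
  [seq edge_part x y e | e <- enum E & off x e < off y e].

Lemma off_ge0 x e : 0 <= off x e. Proof. exact: clamp_ge0. Qed.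
Lemma off_le1 x e : off x e <= 1. Proof. exact: clamp_le1. Qed.
Lemma off_le x y e : x <= y -> off x e <= off y e.
Proof. by move=> xy; apply: clamp_le; lra. Qed.
Lemma off_lo x e : x <= (pos e)%:R -> off x e = 0.
Proof. by move=> xe; apply: clamp0; lra. Qed.
Lemma off_hi x e : (pos e).+1%:R <= x -> off x e = 1.
Proof. by rewrite -natr1 => xe; apply: clamp1; lra. Qed.
Lemma off_lt1 x e : x < (pos e).+1%:R -> off x e < 1.
Proof.
rewrite -natr1 => xe; have [xp|xp] := leP x (pos e)%:R; first by rewrite off_lo.
by rewrite /off clamp_id; lra.
Qed.
Lemma off_0 e : off 0 e = 0. Proof. exact: off_lo. Qed.
Lemma off_m e : off m e = 1. Proof. by rewrite off_hi // ler_nat. Qed.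

Lemma off_lt_pos x y e : off x e < off y e ->
  x < (pos e).+1%:R /\ (pos e)%:R < y.
Proof.
move=> xy; split; rewrite ltNge; apply/negP.
  by move=> /off_hi xe; have := off_le1 y e; rewrite xe in xy; lra.
by move=> /off_lo ye; have := off_ge0 x e; rewrite ye in xy; lra.
Qed.

Lemma arc_pieceP x y I : reflect
  (exists2 e, off x e < off y e & I = edge_part x y e) (I \in arc_piece x y).
Proof.
apply: (iffP mapP) => [[e]|[e xy ->]]; last first.
  by exists e => //; rewrite mem_filter xy mem_enum.
by rewrite mem_filter => /andP[xy _] ->; exists e.
Qed.

Lemma mem_edge_part x y e z :
  ((edge_part x y e).2.1 <= z <= (edge_part x y e).2.2) =
  (off x e <= flip e z <= off y e).
Proof. by rewrite /edge_part /flip; case: (fwd e) => //=; apply/idP/idP; lra. Qed.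

Lemma piece_arc_piece x y : piece (arc_piece x y).
Proof.
move=> I /arc_pieceP[e xy ->]; rewrite /wf_subint /edge_part.
have := off_ge0 x e; have := off_le1 x e; have := off_ge0 y e; have := off_le1 y e.
by case: (fwd e) => /=; repeat split; lra.
Qed.

Lemma in_arc_piece x y e z : off x e < off y e -> off x e <= flip e z <= off y e ->
  in_piece ends (arc_piece x y) (e, z).
Proof.
move=> xy zxy; exists (edge_part x y e); first by apply/arc_pieceP; exists e.
by exists z; rewrite mem_edge_part; split => //; left.
Qed.

(** Only endpoints are identified with other points, so an interior point can enter the piece only
    through its own edge. *)
Lemma in_arc_piece_interior x y e z : z != 0 -> z != 1 ->
  in_piece ends (arc_piece x y) (e, z) ->
  off x e < off y e /\ off x e <= flip e z <= off y e.
Proof.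
move=> z0 z1 [_ /arc_pieceP[f xy ->] [w []]]; rewrite mem_edge_part => wxy.
case=> [[-> ->] //|[v []]].
by rewrite /endvertex /= (negPf z0) (negPf z1).
Qed.

Lemma in_piece_cat (s1 s2 : seq subint) p :
  in_piece ends (s1 ++ s2) p <-> in_piece ends s1 p \/ in_piece ends s2 p.
Proof.
split=> [[I]|[[I Is ?]|[I Is ?]]].
- by rewrite mem_cat => /orP[] Is ?; [left | right]; exists I.
- by exists I => //; rewrite mem_cat Is.
- by exists I => //; rewrite mem_cat Is orbT.
Qed.

Definition co_piece x y := arc_piece 0 x ++ arc_piece y m.

Lemma piece_co_piece x y : piece (co_piece x y).
Proof. by move=> I; rewrite mem_cat => /orP[]; exact: piece_arc_piece. Qed.

Lemma division_arc_piece x y : x <= y -> division ends (arc_piece x y) (co_piece x y).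
Proof.
move=> xy; split; first exact: piece_arc_piece.
split; first exact: piece_co_piece; split.
  move=> [e z] /=; rewrite /in_cake /= => z01.
  have w01 : 0 <= flip e z <= 1 by rewrite /flip; case: (fwd e); lra.
  have o := off_le e xy; have [wx|xw] := ltP (flip e z) (off x e).
    right; apply/in_piece_cat; left; apply: in_arc_piece; rewrite off_0; lra.
  have [yw|wy] := ltP (off y e) (flip e z).
    right; apply/in_piece_cat; right; apply: in_arc_piece; rewrite off_m; lra.
  have [oxy|oyx] := ltP (off x e) (off y e).
    by left; apply: in_arc_piece => //; rewrite xw.
  (* The degenerate part of [e] is not in the arc. The point sits at the common cut, hence in the
     prefix, or in the suffix if the cut is at the tail. *)
  right; apply/in_piece_cat; have [x0|x0] := ltP 0 (off x e).
    by left; apply: in_arc_piece; rewrite off_0; lra.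
  by right; apply: in_arc_piece; rewrite off_m; lra.
(* Besides the endpoints of an edge, only its two cut points can be common. *)
apply: (@sub_finite_set _ _ [set` [seq (e, z) | e <- enum E,
  z <- [:: 0; 1; flip e (off x e); flip e (off y e)]]]); last exact: finite_seq.
move=> [e z] [_ [za zb]].
apply/allpairsPdep; exists e, z; split => //; first by rewrite mem_enum.
rewrite !inE; have [//|z0] := eqVneq z 0; have [//|z1 /=] := eqVneq z 1.
have [_ wa] := in_arc_piece_interior z0 z1 za.
have wE w : flip e z = w -> z = flip e w.
  by move=> <-; rewrite /flip; case: (fwd e) => //; lra.
case/in_piece_cat: zb => /(in_arc_piece_interior z0 z1) [_ wb].
  have /wE -> : flip e z = off x e by lra.
  by rewrite eqxx.
have /wE -> : flip e z = off y e by lra.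
by rewrite eqxx orbT.
Qed.

Lemma touch_tl x y e : off x e = 0 -> touch ends (edge_part x y e) (tl e).
Proof.
move=> x0; exists (flip e 0).
  rewrite mem_edge_part x0 /flip; have := off_ge0 y e; case: (fwd e); lra.
rewrite /endvertex /flip /fwd /=; have [e_th|] := eqVneq (ends e) (tl e, hd e); first by rewrite eqxx e_th.
by case: (ends_tl_hd e) => [->|->]; rewrite ?eqxx // subr0 oner_eq0 eqxx.
Qed.

Lemma touch_hd x y e : off y e = 1 -> touch ends (edge_part x y e) (hd e).
Proof.
move=> y1; exists (flip e 1).
  rewrite mem_edge_part y1 /flip; have := off_le1 x e; case: (fwd e); lra.
rewrite /endvertex /flip /fwd /=; have [e_th|] := eqVneq (ends e) (tl e, hd e).
  by rewrite oner_eq0 eqxx e_th.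
by case: (ends_tl_hd e) => [->|->]; rewrite ?eqxx // subrr eqxx.
Qed.

(** As [f] precedes [e] and [e] starts before [y], the part of [f] reaches its head; as [x] is not
    past the start of [e], the part of [e] contains its tail. They meet at that vertex. *)
Lemma arc_piece_parent x y e f : off x e < off y e -> x <= (pos e)%:R ->
  (pos f < pos e)%N -> x < (pos f).+1%:R -> hd f = tl e ->
  edge_part x y f \in arc_piece x y /\
  meet ends (edge_part x y f) (edge_part x y e).
Proof.
move=> /off_lt_pos[_ ey] xe fe xf fe_v.
have y1 : off y f = 1.
  by rewrite off_hi // (le_trans _ (ltW ey)) // ler_nat.
split; first by apply/arc_pieceP; exists f => //; rewrite y1 off_lt1.
apply: touch_meet (touch_hd _ y1) _; rewrite fe_v; apply: touch_tl.
exact: off_lo.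
Qed.

Lemma prefix_linked x e : off 0 e < off x e -> tl e = root \/
  exists2 J, J \in arc_piece 0 x &
    (pos J.1 < pos e)%N /\ meet ends J (edge_part 0 x e).
Proof.
move=> ex; have [->|[f fe hf]] := tl_prefix e; [by left | right].
have [Jp Jm] := arc_piece_parent ex (ler0n _ _) fe (ltr0Sn _ _) hf.
by exists (edge_part 0 x f).
Qed.

(** [e0] is the edge containing [x]; at [x = m] there is none, but then no part is nondegenerate. A
    later edge hangs from [op e0], or from the head of an edge not before [e0], which the arc
    contains. *)
Lemma suffix_linked x y e0 e : (x < m -> (pos e0)%:R <= x < (pos e0).+1%:R) ->
  off x e < off y e -> e = e0 \/ (off x e = 0 /\ tl e \in op e0) \/
  exists2 J, J \in arc_piece x y &
    (pos J.1 < pos e)%N /\ meet ends J (edge_part x y e).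
Proof.
move=> xe0 exy; have [xe _] := off_lt_pos exy.
have /xe0/andP[e0x xe0'] : x < m by apply: (lt_le_trans xe); rewrite ler_nat.
have : (pos e0 <= pos e)%N by rewrite -ltnS -(ltr_nat R) (le_lt_trans e0x).
rewrite leq_eqVlt => /orP[/eqP /pos_inj ->|e0e]; [by left | right].
have xe' : x <= (pos e)%:R by rewrite ltW // (lt_le_trans xe0') // ler_nat.
have [te|[f /andP[e0f fe] hf]] := tl_open e0e.
  by left; split => //; exact: off_lo.
have xf : x < (pos f).+1%:R by rewrite (lt_le_trans xe0') // ler_nat.
have [Jp Jm] := arc_piece_parent exy xe' fe xf hf.
by right; exists (edge_part x y f).
Qed.

Lemma edge_under x : 0 <= x -> (0 < #|E|)%N ->
  exists e, x < m -> (pos e)%:R <= x < (pos e).+1%:R.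
Proof.
move=> x0 E0; have [xm|mx] := ltP x m; last first.
  by have [e _] := pos_onto E0; exists e.
have /pos_onto[e ee] : (Num.truncn x < #|E|)%N.
  by rewrite -(ltr_nat R); apply: le_lt_trans xm; rewrite truncn_le.
by exists e => _; rewrite ee; exact: truncn_itv.
Qed.

(* The labels: [Some v] collects the parts touching [v], and [None] the single
   part [I0] at which the arc starts. *)
Definition label (I0 : subint) (c : option V) (I : subint) : Prop :=
  if c is Some v then touch ends I v else I = I0.

Lemma label_meet s I0 c (I J : subint) : piece s -> I \in s -> J \in s ->
  label I0 c I -> label I0 c J -> meet ends I J.
Proof.
case: c => [v|] ps Is Js /=; first exact: touch_meet.
by move=> IE JE; rewrite {1}IE -JE; apply: meet_refl; exact: ps.
Qed.

Lemma size_labels e : (size (None :: map Some (op e)) <= r.+2)%N.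
Proof. by rewrite /= size_map ltnS; have [] := op_root_size e. Qed.

(** Stepping back to earlier edges ends at the part of [e0], labelled [None], or at a tail in
    [op e0]: at most 1 + (r + 1) labels. *)
Lemma num_components_arc_piece x y : 0 <= x -> (0 < #|E|)%N ->
  (num_components ends (arc_piece x y) <= r.+2)%N.
Proof.
move=> x0 E0; have [e0 xe0] := edge_under x0 E0.
apply: leq_trans (size_labels e0).
apply: (num_components_leq (tau := label (edge_part x y e0)) (rk := fun I => pos I.1)).
  by move=> c I J; apply: label_meet; exact: piece_arc_piece.
move=> I /arc_pieceP[e exy ->].
have [->|[[x_e te]|]] := suffix_linked xe0 exy; last by right.
  by left; exists None; rewrite ?inE.
left; exists (Some (tl e)); last exact: touch_tl.
by rewrite inE /= map_f.
Qed.

(** Stepping back in the prefix ends at [root], already a label because it lies in [op e0]; the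
    suffix is treated like an arc. *)
Lemma num_components_co_piece x y : 0 <= y -> (0 < #|E|)%N ->
  (num_components ends (co_piece x y) <= r.+2)%N.
Proof.
move=> y0 E0; have [e0 ye0] := edge_under y0 E0.
apply: leq_trans (size_labels e0).
apply: (num_components_leq (tau := label (edge_part y m e0)) (rk := fun I => pos I.1)).
  by move=> c I J; apply: label_meet; exact: piece_co_piece.
move=> I; rewrite mem_cat => /orP[] /arc_pieceP[e exy ->].
  have [er|[J Js Je]] := prefix_linked exy; last first.
    by right; exists J => //; rewrite mem_cat Js.
  left; exists (Some root); last by rewrite /= -er; apply: touch_tl; exact: off_0.
  by rewrite inE /= map_f //; have [] := op_root_size e0.
have [->|[[x_e te]|[J Js Je]]] := suffix_linked ye0 exy.
- by left; exists None; rewrite ?inE.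
- left; exists (Some (tl e)); last exact: touch_tl.
  by rewrite inE /= map_f.
- by right; exists J => //; rewrite mem_cat Js orbT.
Qed.

(** * The value of an arc *)

Section Value.
Variable mu : E -> {measure set R -> \bar R}.
Hypothesis mu_val : valuation mu.

Let mu_out e : mu e [set x : R | ~ (0 <= x <= 1)] = 0%E.
Proof. by case: mu_val. Qed.
Let mu_atom e (x : R) : mu e [set x] = 0%E.
Proof. by case: mu_val => _ []. Qed.
Let mu_total : (\sum_(e : E) mu e [set x : R | (0 <= x <= 1)%R] = 1)%E.
Proof. by case: mu_val => _ []. Qed.
Let mu_fin e : (mu e [set x : R | (0 <= x <= 1)%R] < +oo)%E.
Proof.
apply: (@le_lt_trans _ _ 1%E); last exact: ltry.
by rewrite -mu_total (bigD1 e) //= leeDl // sume_ge0.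
Qed.

Definition cake_cdf (z : R) : R :=
  \sum_(e : E) cumul (mu e) (fwd e) (z - (pos e)%:R).

Lemma cake_cdf_continuous : continuous cake_cdf.
Proof.
apply: continuous_big => [|e _ z]; first exact: add_continuous.
have c1 : {for z, continuous (fun z : R => z - (pos e)%:R)}.
  by apply: continuousB; [exact: cvg_id | exact: cvg_cst].
exact: (continuous_comp c1
  (@cumul_continuous _ _ (mu_out e) (mu_atom e) (mu_fin e) (fwd e) _)).
Qed.

Lemma cake_cdf_homo : {homo cake_cdf : x y / x <= y}.
Proof.
by move=> x y xy; apply: ler_sum => e _; apply: cumul_homo => //; lra.
Qed.

Lemma cake_cdf0 : cake_cdf 0 = 0.
Proof.
rewrite /cake_cdf big1 // => e _; apply: cumul0 => //.
Qed.

Lemma cake_cdf_m : cake_cdf m = 1.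
Proof.
apply: EFin_inj; rewrite -mu_total /cake_cdf -sumEFin; apply: eq_bigr => e _.
rewrite cumul1 //; last first.
  by rewrite lerBrDr addrC natr1 ler_nat.
by rewrite fineK ?nu_fin_num // nu_setT // unit_itvE.
Qed.

(** Through other edges the piece may gain the endpoints of [e], so its trace differs from the
    interval of [edge_part] at most at 0 and 1, which are null. *)
Lemma piece_on_arc_piece x y e : x <= y ->
  measurable (piece_on ends (arc_piece x y) e) /\
  mu e (piece_on ends (arc_piece x y) e) =
    (cumul (mu e) (fwd e) (y - (pos e)%:R) - cumul (mu e) (fwd e) (x - (pos e)%:R))%:E.
Proof.
move=> xy; set P := piece_on _ _ _.
(* If no part of [e] is kept, the trace lies in the two endpoints and the clamped offsets agree. *)
have [exy|eyx] := ltP (off x e) (off y e); last first.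
  have fin01 : finite_set (P `\` set0).
    apply: (@sub_finite_set _ _ [set 0; 1]) => //.
    move=> z [[_ zP] _] /=; have [->|z0] := eqVneq z 0; [by left | right].
    have [//|z1] := eqVneq z 1.
    by have [] := in_arc_piece_interior z0 z1 zP; rewrite ltNge eyx.
  have [mP ->] := measurable_up_to_finite (mu_atom e) measurable0 (@sub0set _ P) fin01.
  have eE : off x e = off y e by apply/eqP; rewrite eq_le eyx off_le.
  split => //; rewrite measure0 -(cumul_clamp (mu_out e)) //.
  by rewrite -[X in _ - X](cumul_clamp (mu_out e)) // -/(off x e) -/(off y e) eE subrr.
set B := `[(edge_part x y e).2.1, (edge_part x y e).2.2]%classic.
have BP : B `<=` P.
  move=> z; rewrite /B /= in_itv mem_edge_part => zB; split; last exact: in_arc_piece.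
  have := off_ge0 x e; have := off_le1 y e; move: zB; rewrite /flip.
  by case: (fwd e); lra.
have finPB : finite_set (P `\` B).
  apply: (@sub_finite_set _ _ [set 0; 1]) => //.
  move=> z [[_ zP] zB] /=; have [->|z0] := eqVneq z 0; [by left | right].
  have [//|z1] := eqVneq z 1; case: zB.
  rewrite /B /= in_itv mem_edge_part.
  by have [] := in_arc_piece_interior z0 z1 zP.
have [mP ->] := measurable_up_to_finite (mu_atom e) (measurable_itv _) BP finPB.
split => //; rewrite -(cumul_clamp (mu_out e)) //.
rewrite -[X in _ - X](cumul_clamp (mu_out e)) // -/(off x e) -/(off y e).
rewrite /B /edge_part /cumul; case: (fwd e) => /=.
  by rewrite distr_itv //; exact: ltW.
rewrite distr_itv //; first by congr EFin; ring.
by rewrite lerD2l lerN2 ltW.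
Qed.

Lemma value_arc_piece x y : x <= y ->
  value ends mu (arc_piece x y) = (cake_cdf y - cake_cdf x)%:E.
Proof.
move=> xy; rewrite /value /cake_cdf -sumrB -sumEFin; apply: eq_bigr => e _.
by have [] := piece_on_arc_piece e xy.
Qed.

End Value.
End Pieces.

(** * Complementary values and the final assembly *)

Lemma valuation_card_gt0 (R : realType) (E : finType)
    (mu : E -> {measure set R -> \bar R}) : valuation mu -> (0 < #|E|)%N.
Proof.
move=> [_ [_ tot]]; rewrite lt0n; apply/negP => /eqP/card0_eq E0.
move: tot; rewrite big_pred0 // => /eqP; by rewrite eqe eq_sym oner_eq0.
Qed.

Lemma division_sym (R : realType) (V E : finType) (ends : E -> V * V)
    (a b : seq (subint R E)) : division ends a b -> division ends b a.
Proof.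
move=> [pa [pb [cov fin]]]; split => //; split => //; split.
  by move=> p /cov[]; [right | left].
by apply: sub_finite_set fin => p [? [? ?]].
Qed.

(** On each edge the overlap is finite, hence null, so the two values add up to the total mass 1. *)
Lemma value_division (R : realType) (V E : finType) (ends : E -> V * V)
    (mu : E -> {measure set R -> \bar R}) (a b : seq (subint R E)) (v : R) :
  valuation mu -> division ends a b ->
  (forall e, measurable (piece_on ends a e)) ->
  (forall e, measurable (piece_on ends b e)) ->
  value ends mu a = v%:E -> value ends mu b = (1 - v)%:E.
Proof.
move=> [_ [atom tot]] [_ [_ [cov fin]]] ma mb va.
have : (value ends mu a + value ends mu b = 1)%E.
  rewrite -tot /value -big_split /=; apply: eq_bigr => e _.
  set A := piece_on _ _ _; set B := piece_on _ _ _.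
  have AB0 : mu e (A `&` B) = 0%E.
    apply: (finite_set_null (atom e)).
    apply: sub_finite_set (finite_image snd fin) => x [[x01 xa] [_ xb]].
    by exists (e, x).
  have ABE : A `|` B = [set x : R | 0 <= x <= 1].
    apply/seteqP; split => [x [] []//|x x01].
    by have [|xa|xb] := cov (e, x); [|left | right].
  have DE : B = (B `\` A) `|` (A `&` B) by rewrite [A `&` B]setIC setUC setUIDK.
  have mD : measurable (B `\` A) by exact: measurableD (mb e) (ma e).
  have mI : measurable (A `&` B) by exact: measurableI (ma e) (mb e).
  have -> : mu e B = mu e (B `\` A) by rewrite {1}DE (measureU0 mD mI AB0).
  have <- : A `|` (B `\` A) = [set x : R | 0 <= x <= 1] by rewrite -ABE setUDr setDv setD0.
  rewrite measureU //; first exact: ma.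
  by apply/seteqP; split => x // [? []].
rewrite va; case: (value ends mu b) => [w| |] //= [vw].
by congr EFin; lra.
Qed.

Theorem mainTheorem5 (R : realType) (V E : finType) (ends : E -> V * V)
  (muA muB : E -> {measure set R -> \bar R}) (t : R) :
  connected_graph ends ->
  valuation muA -> valuation muB ->
  0 <= t <= 1 ->
  exists a b : seq (subint R E),
    weighted_consensus ends muA muB t a b /\
    (num_components ends a <= (graph_radius ends).+2)%N /\ (num_components ends b <= (graph_radius ends).+2)%N.
Proof.
move=> conn valA valB t01.
have E0 := valuation_card_gt0 valA.
have [e0 _] : exists e : E, e \in predT by apply/card_gt0P.
have [root [pos [tl [hd [op [inj [lt [onto [arcs [pre [tr size_op]]]]]]]]]]] :=
  traversal_order (ends e0).1 conn.
pose F := cake_cdf ends pos tl hd muA; pose G := cake_cdf ends pos tl hd muB.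
have [x [y [x0 [xy [ym FG]]]]] : exists x y : R, 0 <= x /\ x <= y /\ y <= #|E|%:R /\
    ((F y - F x = t /\ G y - G x = t) \/ (F y - F x = 1 - t /\ G y - G x = 1 - t)).
  apply: two_measure_arc => //; try exact: cake_cdf_continuous;
    try exact: cake_cdf_homo; try exact: cake_cdf0; try exact: cake_cdf_m.
set a := arc_piece ends pos tl hd x y.
set b := co_piece ends pos tl hd x y.
have div : division ends a b by apply: division_arc_piece.
have ma e : measurable (piece_on ends a e).
  by have [] := piece_on_arc_piece ends pos tl hd valA e xy.
have mb e : measurable (piece_on ends b e).
  have -> : piece_on ends b e = piece_on ends (arc_piece ends pos tl hd 0 x) e `|`
      piece_on ends (arc_piece ends pos tl hd y #|E|%:R) e.
    apply/seteqP; split => z.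
      by move=> [z01 /in_piece_cat[]]; [left | right].
    by case=> [] [z01 zp]; split => //; apply/in_piece_cat; [left | right].
  apply: measurableU.
    by have [] := piece_on_arc_piece ends pos tl hd valA e x0.
  by have [] := piece_on_arc_piece ends pos tl hd valA e ym.
have Aa : value ends muA a = (F y - F x)%:E by apply: value_arc_piece.
have Ba : value ends muB a = (G y - G x)%:E by apply: value_arc_piece.
have Ab := value_division valA div ma mb Aa.
have Bb := value_division valB div ma mb Ba.
have y0 := le_trans x0 xy.
have na : (num_components ends a <= (graph_radius ends).+2)%N.
  exact: (num_components_arc_piece inj lt onto arcs tr size_op).
have nb : (num_components ends b <= (graph_radius ends).+2)%N.
  exact: (num_components_co_piece inj lt onto arcs pre tr size_op).
(* If the arc has measure 1 - t for both agents, it takes the role of the second piece. *)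
case: FG => -[Ft Gt]; rewrite ?Ft ?Gt ?subKr in Aa Ba Ab Bb.
  by exists a, b.
by exists b, a; split => //; split => //; exact: division_sym.
Qed.
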